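(* Let $\pi_\varepsilon$ be the (unique) optimizer of the quadratically regularized optimal transport problem $$\mathrm{QOT}_\varepsilon(\mu,\nu)=\inf_{\pi\in\Pi(\mu,\nu)}\Big\{\int c\,d\pi+\frac{\varepsilon}{2}\Big\|\frac{d\pi}{dP}\Big\|_{L^2(P)}^2\Big\},\qquad c(x,y)=\tfrac12\|x-y\|^2,\ P=\mu\otimes\nu,$$ and let the following assumptions hold: (i) there is a bounded connected open Lipschitz domain $\Omega\subset B(0,1)\subset\mathbb{R}^d$ with $\mu(dx)=\rho_\mu(x)\mathbf 1_\Omega(x)\,dx$ and $0<\underline\lambda_\mu\le\rho_\mu\le\overline\lambda_\mu<\infty$ a.e. on $\Omega$; (ii) $\nu\ll\mathrm{Leb}$, $\mathrm{spt}\,\nu\subseteq B(0,1)$, and $d\nu/dy\le\overline\lambda_\nu<\infty$ on $\mathrm{spt}\,\nu$; (iii) the Monge (Brenier) map $T=\nabla\varphi$ from $\mu$ to $\nu$ is $L$-Lipschitz. Set $$C_0:=\overline\lambda_\nu(1+L^2)^{d/2}\omega_d,\qquad C_{\mathrm{lin}}:=\int c\,dP-\mathrm{OT}(\mu,\nu)+\frac12,$$ where $\omega_d=\pi^{d/2}/\Gamma(\frac d2+1)$ is the volume of the unit ball and $\mathrm{OT}(\mu,\nu)=\inf_{\pi\in\Pi(\mu,\nu)}\int c\,d\pi$. Let $C_{\mathrm{val}}\ge 1$ be a constant such that the value gap $\Delta_\varepsilon:=\mathrm{QOT}_\varepsilon(\mu,\nu)-\mathrm{OT}(\mu,\nu)$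 satisfies $C_{\mathrm{val}}^{-1}\varepsilon^{\frac{2}{2+d}}\le\Delta_\varepsilon\le C_{\mathrm{val}}\varepsilon^{\frac{2}{2+d}}$ for all $\varepsilon\in(0,1]$ (such a constant exists by the convergence rates of Eckstein–Nutz for compactly supported marginals). Then, with $$c_{\mathrm{sm}}=\Big(\frac1{2C_0C_{\mathrm{val}}}\Big)^{1/d},\qquad c_{\mathrm{lg}}=\Big(\frac1{2C_0C_{\mathrm{lin}}}\Big)^{1/d}>0,$$ for all $\varepsilon>0$, $$\mathrm{dist}\bigl(\mathrm{spt}\,\pi_\varepsilon;\mathrm{gr}\,T\bigr)\ge\begin{cases}c_{\mathrm{sm}}\varepsilon^{\frac{1}{2+d}},&\varepsilon\in(0,1],\\ c_{\mathrm{lg}},&\varepsilon\ge1,\end{cases}$$ where $\mathrm{gr}\,T=\{(x,T(x)):x\in\mathbb{R}^d\}$ and $\mathrm{dist}(A;B)=\sup_{a\in A}\inf_{b\in B}\|a-b\|$ is the directed Hausdorff distance in $\mathbb{R}^d\times\mathbb{R}^d$. In particular, $\mathrm{dist}(\mathrm{spt}\,\pi_\varepsilon;\mathrm{gr}\,T)\ge\min\{c_{\mathrm{sm}}\varepsilon^{\frac{1}{2+d}},c_{\mathrm{lg}}\}$ for all $\varepsilon>0$.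
   Context: Quadratically regularized optimal transport with quadratic cost $c(x,y)=\frac12\|x-y\|^2$ between compactly supported probability measures $\mu,\nu$ on $\mathbb{R}^d$ (supports in the unit ball), with reference measure $P=\mu\otimes\nu$ and optimizer $\pi_\varepsilon\ll P$. $\Pi(\mu,\nu)$ is the set of couplings of $\mu$ and $\nu$. The constants $c_{\mathrm{sm}},c_{\mathrm{lg}}$ depend only on $d$, $L$, $\overline\lambda_\nu$, $C_{\mathrm{val}}$ (and $C_{\mathrm{lin}}$). *)

(* Defs.v *)
From HB Require Import structures.
From mathcomp Require Import all_boot all_order all_algebra.
From mathcomp Require Import all_classical all_reals all_analysis.
Import Order.TTheory GRing.Theory Num.Theory.
Import numFieldNormedType.Exports.
Set Implicit Arguments.
Unset Strict Implicit.
Unset Printing Implicit Defensive.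
Local Open Scope classical_set_scope.
Local Open Scope ring_scope.

HB.instance Definition _ (R : realType) (n : nat) :=
  Measurable.copy 'rV[R]_n (g_sigma_algebraType (@open 'rV[R]_n)).

Section QOT_defs.
Variables (R : realType) (d : nat).
Local Notation V := 'rV[R]_d.

Definition dotv (x y : V) : R := \sum_i x 0 i * y 0 i.
Definition enorm (x : V) : R := Num.sqrt (dotv x x).

Definition eball (c : V) (r : R) : set V := [set x | enorm (x - c) < r].

Definition pdist (z w : V * V) : R :=
  Num.sqrt (enorm (z.1 - w.1) ^+ 2 + enorm (z.2 - w.2) ^+ 2).

Definition hdist (A B : set (V * V)%type) : \bar R :=
  ereal_sup [set ereal_inf [set (pdist a b)%:E | b in B] | a in A].

Definition cost (z : V * V) : R := 2^-1 * enorm (z.1 - z.2) ^+ 2.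

(* d-dimensional Lebesgue (outer) measure: infimum of total volumes of
   countable covers by closed boxes. On Borel sets it is Lebesgue measure. *)
Definition box (a b : V) : set V := [set x | forall i, a 0 i <= x 0 i <= b 0 i].
Definition boxvol (a b : V) : R := \prod_i (b 0 i - a 0 i).
Definition lebesgue_d (A : set V) : \bar R :=
  ereal_inf [set (\sum_(k <oo) (boxvol (ab.1 k) (ab.2 k))%:E)%E |
    ab in [set ab : ((nat -> V) * (nat -> V))%type |
      (forall k i, ab.1 k 0 i <= ab.2 k 0 i) /\
      A `<=` \bigcup_k box (ab.1 k) (ab.2 k)]].

Definition mspt {T : topologicalType} (m : set T -> \bar R) : set T :=
  [set x | forall U, open U -> U x -> (0 < m U)%E].

Definition graph_of (T : V -> V) : set (V * V)%type := [set (x, T x) | x in setT].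

(* Lipschitz domain: bounded connected open set whose boundary is locally,
   after a rigid rotation, the strict hypograph of a Lipschitz function of
   the remaining d-1 coordinates. *)
Definition lipschitz_on_V (h : V -> R) := exists K : R,
  forall y y' : V, `|h y - h y'| <= K * enorm (y - y').
Definition lipschitz_boundary (O : set V) :=
  forall p, closure O p -> ~ O p ->
  exists (r : R) (Q : 'M[R]_d) (j : 'I_d) (h : V -> R),
    [/\ 0 < r, Q *m Q^T = 1%:M, lipschitz_on_V h,
        (forall y y' : V, (forall i, i != j -> y 0 i = y' 0 i) -> h y = h y') &
        forall x, eball p r x ->
          (O x <-> ((x - p) *m Q) 0 j < h ((x - p) *m Q))].
Definition lipschitz_domain (O : set V) :=
  [/\ open O, connected O, (exists M : R, forall x, O x -> enorm x <= M) &
      lipschitz_boundary O].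

Definition convex_fun (phi : V -> R) := forall (x y : V) (t : R), 0 <= t <= 1 ->
  phi ((1 - t) *: x + t *: y) <= (1 - t) * phi x + t * phi y.
Definition has_gradient (phi : V -> R) (x g : V) :=
  differentiable phi x /\ forall v : V, 'd phi x v = dotv g v.

Definition Gamma (s : R) : R :=
  fine (\int[lebesgue_measure]_(t in `]0%R, +oo[)
          ((t `^ (s - 1)) * expR (- t))%:E)%E.
Definition omega_d : R := pi `^ (d%:R / 2) / Gamma (d%:R / 2 + 1).

Definition couplings (mu nu : probability V R) : set (probability (V * V)%type R) :=
  [set p | forall A : set V, measurable A ->
     p (A `*` setT) = mu A /\ p (setT `*` A) = nu A].
Definition transport_cost (p : set (V * V)%type -> \bar R) : \bar R :=
  (\int[p]_z (cost z)%:E)%E.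
Definition OT (mu nu : probability V R) : \bar R :=
  ereal_inf [set transport_cost p | p in couplings mu nu].
Definition is_density (p P : set (V * V)%type -> \bar R) (f : V * V -> R) :=
  [/\ measurable_fun setT f, (forall z, 0 <= f z) &
      forall A, measurable A -> p A = (\int[P]_(z in A) (f z)%:E)%E].
Definition QOT_obj (eps : R) (mu nu : probability V R)
    (p : set (V * V)%type -> \bar R) (f : V * V -> R) : \bar R :=
  (transport_cost p + (eps / 2)%:E * \int[(mu \x nu)%E]_z ((f z) ^+ 2)%:E)%E.
(* couplings not absolutely continuous wrt P have value +oo, hence are
   excluded from the infimum *)
Definition QOT (eps : R) (mu nu : probability V R) : \bar R :=
  ereal_inf [set QOT_obj eps mu nu pf.1 pf.2 |
    pf in [set pf : probability (V * V)%type R * (V * V -> R) |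
      couplings mu nu pf.1 /\ is_density pf.1 (mu \x nu)%E pf.2]].
Definition is_QOT_optimizer (eps : R) (mu nu : probability V R)
    (p : probability (V * V)%type R) :=
  couplings mu nu p /\ exists f, is_density p (mu \x nu)%E f /\
    QOT_obj eps mu nu p f = QOT eps mu nu.

End QOT_defs.

(* Main.v *)
Require Import Defs.
From HB Require Import structures.
From mathcomp Require Import all_boot all_order all_algebra.
From mathcomp Require Import all_classical all_reals all_analysis.
From mathcomp Require Import measurable_realfun ring lra.
Import Order.TTheory GRing.Theory Num.Theory.
Import numFieldNormedType.Exports.
Local Open Scope classical_set_scope.
Local Open Scope ring_scope.

(** If [spt pi_eps] lies in the [r]-neighbourhood of [gr T], then, [T] being
    [L]-Lipschitz, it lies in the tube [|y - T x| < sqrt (1 + L^2) r], whose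
    sections are balls; hence [P] charges it with at most [C0 r^d].  A density
    of mass 1 on a set of [P]-mass [q] has squared L2-norm at least [1 / q], so
    the regularization term is at least [eps / (2 C0 r^d)].  It is also at most
    [QOT - OT], which is bounded by [C_val eps^(2/(2+d))] for [eps <= 1] and, by
    testing with [P] itself, by [C_lin eps] for [eps >= 1].

    The constant [omega_d] is the Lebesgue measure of the unit ball: integrating
    [exp (-|x|^2)] by layers gives [pi^(d/2) = |B| Gamma(d/2 + 1)].  The outer
    measure [lebesgue_d] is identified on Borel sets with an iterated product
    measure, to which Fubini applies. *)

(** * Borel sets of row vectors and supports of measures *)

(** Second countability with an enumerated base, so that unions of open sets become countable ones;
    the sets [W n] may repeat or be empty. *)
Definition countable_base {T : topologicalType} (W : nat -> set T) :=
  (forall n, open (W n)) /\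
  forall U x, open U -> U x -> exists n, W n x /\ W n `<=` U.

Lemma open_bigcup_base {T : topologicalType} (W : nat -> set T) (U : set T) :
  countable_base W -> open U -> U = \bigcup_(n in [set n | W n `<=` U]) W n.
Proof.
move=> [_ Wb] oU; apply/seteqP; split => [x Ux|x [n /= WU /WU]//].
by have [n [Wx WU]] := Wb U x oU Ux; exists n.
Qed.

(** Pairs of indices are coded by one number through [pickle]; a number that codes no pair receives
    the empty set. *)
Lemma countable_baseX {S T : topologicalType} (V : nat -> set S)
    (W : nat -> set T) : countable_base V -> countable_base W ->
  countable_base (fun n => if unpickle n is Some ij
    then V ij.1 `*` W ij.2 else set0).
Proof.
move=> [oV bV] [oW bW]; split.
  move=> n; case: unpickle => [[i j]/=|]; last exact: open0.
  rewrite openE => -[x y] [/= Vx Wy]; exists (V i, W j) => //.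
  by split => /=; apply: open_nbhs_nbhs; split => //=.
move=> U [x y] oU Uxy.
have /= [[A B] [nA nB] ABU] : nbhs (x, y) U by exact: open_nbhs_nbhs.
move: nA nB; rewrite !nbhsE => -[A' [oA A'x] AA] [B' [oB B'y] BB].
have [i [Vx VA]] := bV _ _ oA A'x; have [j [Wy WB]] := bW _ _ oB B'y.
exists (pickle (i, j)); rewrite pickleK/=; split => // -[a b] /= [Va Wb].
by apply: ABU; split => /=; [apply: AA; exact: VA|apply: BB; exact: WB].
Qed.

Lemma mspt_closed {T : topologicalType} {R : realType} (m : set T -> \bar R) :
  closed (mspt m).
Proof.
rewrite -[mspt m]setCK; apply: open_closedC; rewrite openE => x.
move=> /existsNP[U]; rewrite !not_implyE => -[oU [Ux mU]].
rewrite /interior nbhsE/=; exists U => // y Uy /(_ U oU Uy).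
by move/mU.
Qed.

(** By monotonicity a null open neighbourhood contains a null base set around the point. The
    complement of the support thus becomes a countable union of null sets. *)
Lemma setC_mspt_bigcup {T : topologicalType} {R : realType}
    (m : set T -> \bar R) (W : nat -> set T) : countable_base W ->
  (forall A B, open A -> open B -> A `<=` B -> (m A <= m B)%E) ->
  ~` mspt m = \bigcup_(n in [set n | (m (W n) <= 0)%E]) W n.
Proof.
move=> [oW bW] mle; apply/seteqP; split => x.
  move=> /existsNP[U]; rewrite !not_implyE => -[oU [Ux /negP]].
  rewrite -leNgt => mU; have [n [Wx WU]] := bW _ _ oU Ux.
  by exists n => //=; apply: le_trans mU; exact: mle.
by move=> [n /= W0 Wx] /(_ _ (oW n) Wx); rewrite ltNge W0.
Qed.

Section row_vectors.
Context {R : realType} {d : nat}.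
Local Notation V := 'rV[R]_d.

(** [ball] is the ball of the sup norm, unlike the Euclidean [eball]; the condition [0 < e] covers
    the case of no coordinates. *)
Lemma rV_ballP (c x : V) e :
  ball c e x <-> 0 < e /\ forall i, `|c 0 i - x 0 i| < e.
Proof.
split=> [[e0 H]|[e0 H]]; split => // i; first exact: H.
by move=> j; rewrite ord1; exact: H.
Qed.

Definition rat_ball (n : nat) : set V :=
  if unpickle n is Some qk
  then ball (map_mx ratr (qk.1 : 'rV[rat]_d) : V) (qk.2.+1%:R^-1 : R)
  else set0.

Lemma rat_ball_base : countable_base rat_ball.
Proof.
split=> [n|U x oU Ux].
  by rewrite /rat_ball; case: unpickle => [[q k]|]; [exact: ball_open|exact: open0].
have /nbhs_ballP[e /= e0 eU] : nbhs x U by exact: open_nbhs_nbhs.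
(* The radius is taken below [e / 2] because two points of one rational ball are less than twice its
   radius apart. *)
have [k ke] : exists k : nat, k.+1%:R^-1 < e / 2.
  have e20 : 0 < e / 2 by rewrite divr_gt0.
  by have [k] := ltr_add_invr e20; rewrite add0r; exists k.
have : 0 < k.+1%:R^-1 :> R by rewrite invr_gt0.
move rE : (k.+1%:R^-1 : R) ke => r ke r0.
have H i : exists q : rat, `|ratr q - x 0 i| < r.
  have /rat_in_itvoo[q] : x 0 i - r < x 0 i + r by lra.
  by rewrite in_itv/= => qx; exists q; rewrite ltr_norml; lra.
have [q Hq] := choice H.
have qx : ball (map_mx ratr (\row_i q i) : V) r x.
  by apply/rV_ballP; split => // i; rewrite !mxE.
exists (pickle (\row_i q i : 'rV[rat]_d, k)).
rewrite /rat_ball pickleK/= rE; split => // y qy.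
by apply: eU; have := ball_triangle (ball_sym qx) qy; apply: le_ball; lra.
Qed.

(** A rational ball is a finite intersection of strict half-spaces, which arise from closed ones by
    countable unions and complements, and an open set is a countable union of rational balls. Stated
    for any [M], this is an induction principle for Borel sets. *)
Lemma rV_halfspace_borel (M : set (set V)) : sigma_algebra setT M ->
  (forall i c, M [set x | x 0 i <= c]) -> (measurable : set (set V)) `<=` M.
Proof.
move=> sM hM; apply: smallest_sub => // U oU.
have [M0 MC MU] := sM.
have MC' A : M A -> M (~` A) by move=> /MC; rewrite setTD.
have MI A B : M A -> M B -> M (A `&` B).
  move=> MA MB; rewrite -[_ `&` _]setCK setCI -bigcup2E; apply/MC'/MU.
  by case=> [|[|k]] /=; [exact: MC'|exact: MC'|exact: M0].
have Mlt i c : M [set x | x 0 i < c].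
  rewrite (_ : mkset _ = \bigcup_n [set x | x 0 i <= c - n.+1%:R^-1]).
    by apply: MU => n; exact: hM.
  apply/seteqP; split => [x /= xc|x [n _ /=]].
    by have /ltr_add_invr[k xk] := xc; exists k => //=; rewrite lerBrDr ltW.
  by move=> /le_lt_trans; apply; rewrite ltrBlDr ltrDl invr_gt0.
have Mbig (s : seq 'I_d) (P : 'I_d -> set V) : (forall i, M (P i)) ->
    M [set x | forall i, i \in s -> P i x].
  move=> MP; elim: s => [|a s IH].
    rewrite (_ : mkset _ = ~` set0); first exact/MC'/M0.
    by rewrite setC0; apply/seteqP; split => x.
  rewrite (_ : mkset _ = P a `&` [set x | forall i, i \in s -> P i x]).
    exact: MI.
  apply/seteqP; split => x /= => [H|[H1 H2] i].
    by split=> [|i is_]; apply: H; rewrite inE ?eqxx// is_ orbT.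
  by rewrite inE => /predU1P[->//|]; exact: H2.
rewrite (open_bigcup_base _ _ rat_ball_base oU) bigcup_mkcond; apply: MU => n.
case: ifPn => // _; rewrite /rat_ball; case: unpickle => [[q k]|//] /=.
have : 0 < k.+1%:R^-1 :> R by rewrite invr_gt0.
move: (map_mx _ _) (k.+1%:R^-1) => c e e0.
rewrite (_ : ball c e = [set x | forall i, i \in enum 'I_d ->
    (~` [set x : V | x 0 i <= c 0 i - e] `&` [set x | x 0 i < c 0 i + e]) x]).
  apply: (Mbig _ (fun i => _)) => i; apply: MI; last exact: Mlt.
  by apply: MC'; exact: hM.
apply/seteqP; split => x /=.
  move=> /rV_ballP[_ H] i _; have := H i; rewrite ltr_norml => {}H.
  by split; [apply/negP; rewrite -ltNge|]; lra.
move=> H; apply/rV_ballP; split=> // i; have [|/negP] := H i; first by rewrite mem_enum.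
by rewrite -ltNge ltr_norml => H1 H2; lra.
Qed.

Lemma open_rV_measurable (U : set V) : open U -> measurable U.
Proof. exact: sub_sigma_algebra. Qed.

Lemma closed_rV_measurable (C : set V) : closed C -> measurable C.
Proof.
move=> cC; rewrite -[C]setCK; apply: measurableC; apply: open_rV_measurable.
exact: closed_openC.
Qed.

Lemma measurable_coord (i : 'I_d) : measurable_fun setT (fun x : V => x 0 i).
Proof.
apply: (measurability _ (measurable_realfun.RGenOInfty.measurableE R)).
move=> _ [_ [a ->] <-]; rewrite setTI; apply: open_rV_measurable.
apply: open_comp; last exact: interval_open.
by move=> x _; exact: coord_continuous.
Qed.

(** The sets with measurable preimage form a sigma-algebra, so half-spaces suffice. *)
Lemma measurable_rV_fun {d'} {T : measurableType d'} (f : T -> V) :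
  (forall i, measurable_fun setT (fun t => f t 0 i)) -> measurable_fun setT f.
Proof.
move=> mf _ A mA; rewrite setTI.
suff : (measurable : set (set V)) `<=` [set B | measurable (f @^-1` B)] by exact.
apply: rV_halfspace_borel => [|i c /=].
  split => /=; first by rewrite preimage_set0.
  - by move=> B mB; rewrite setTD preimage_setC; exact: measurableC.
  - by move=> F mF; rewrite preimage_bigcup; exact: bigcupT_measurable.
have := mf i measurableT `]-oo, c]%classic (measurable_itv _).
by rewrite setTI; congr (measurable _); apply/seteqP; split => x /=; rewrite in_itv.
Qed.

(** Pairs carry the product sigma-algebra; a countable base of rectangles shows that it contains the
    open sets. *)
Lemma open_rVX_measurable (U : set (V * V)) : open U -> measurable U.
Proof.
move=> oU.
rewrite (open_bigcup_base _ _ (countable_baseX _ _ rat_ball_base rat_ball_base) oU).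
apply: bigcup_measurable => n _; case: unpickle => [[i j]/=|//].
by apply: measurableX; apply: open_rV_measurable; apply rat_ball_base.
Qed.

Lemma closed_rVX_measurable (C : set (V * V)) : closed C -> measurable C.
Proof.
move=> cC; rewrite -[C]setCK; apply: measurableC; apply: open_rVX_measurable.
exact: closed_openC.
Qed.

End row_vectors.

Lemma setC_mspt_null {dT} {T : measurableType dT} {R : realType}
    (m : {measure set T -> \bar R}) (S : set T) (W : nat -> set T) :
  (forall n, measurable (W n)) ->
  S = \bigcup_(n in [set n | (m (W n) <= 0)%E]) W n -> m S = 0%E.
Proof.
move=> mW ->; rewrite bigcup_mkcond; set F := fun n => if _ then _ else _.
have mF n : measurable (F n) by rewrite /F; case: ifPn.
apply/eqP; rewrite -measure_le0.
apply: (@le_trans _ _ (\sum_(n <oo) m (F n))%E).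
  by apply: measure_sigma_subadditive => //; exact: bigcupT_measurable.
rewrite eseries0// => n _ _; apply/eqP; rewrite -measure_le0 /F.
by case: ifPn => [/[!inE]//|_]; rewrite measure0.
Qed.

Lemma mspt_rV_full {R : realType} {d : nat} (m : probability 'rV[R]_d R) :
  m (mspt m) = 1%E.
Proof.
rewrite -[mspt m]setCK probability_setC.
  rewrite (@setC_mspt_null _ _ _ m _ rat_ball) ?sube0//.
    by move=> n; apply: open_rV_measurable; apply rat_ball_base.
  apply: setC_mspt_bigcup => [|A B oA oB AB]; first exact: rat_ball_base.
  by apply: le_measure => //; rewrite inE; exact: open_rV_measurable.
by apply: measurableC; apply: closed_rV_measurable; exact: mspt_closed.
Qed.

Lemma mspt_rVX_full {R : realType} {d : nat}
  (m : probability ('rV[R]_d * 'rV[R]_d)%type R) : m (mspt m) = 1%E.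
Proof.
pose B := countable_baseX _ _ (@rat_ball_base R d) (@rat_ball_base R d).
rewrite -[mspt m]setCK probability_setC.
  rewrite (@setC_mspt_null _ _ _ m _ _ _ (setC_mspt_bigcup _ _ B _)) ?sube0//.
    by move=> n; apply: open_rVX_measurable; apply B.
  move=> A C oA oC AC.
  by apply: le_measure => //; rewrite inE; exact: open_rVX_measurable.
by apply: measurableC; apply: closed_rVX_measurable; exact: mspt_closed.
Qed.

(** * The box-cover outer measure *)

Section box_covers.
Context {R : realType} {d : nat}.
Local Notation V := 'rV[R]_d.
Implicit Types a b : V.

Lemma boxvol_ge0 a b : (forall i, a 0 i <= b 0 i) -> 0 <= boxvol a b.
Proof. by move=> ab; apply: prodr_ge0 => i _; rewrite subr_ge0. Qed.

Lemma lebesgue_d_ge0 (A : set V) : (0 <= lebesgue_d A)%E.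
Proof.
apply: le_ereal_inf_tmp => _ [[a b] /= [ab _] <-].
by apply: nneseries_ge0 => k _ _; rewrite lee_fin boxvol_ge0.
Qed.

Lemma le_lebesgue_d : {homo @lebesgue_d R d : A B / A `<=` B >-> (A <= B)%E}.
Proof.
move=> A B AB; apply: ereal_inf_le_tmp => _ [[a b] /= [ab Bab] <-].
by exists (a, b) => //=; split => //; exact: subset_trans Bab.
Qed.

Lemma box_closed a b : closed (box a b).
Proof.
rewrite (_ : box a b = \bigcap_i [set x : V | a 0 i <= x 0 i <= b 0 i]).
  apply: closed_bigI => i _.
  rewrite (_ : mkset _ = (fun x : V => x 0 i) @^-1` `[a 0 i, b 0 i]%classic).
    by apply: closed_comp => [x _|]; [exact: coord_continuous|exact: interval_closed].
  by apply/seteqP; split => x /=; rewrite in_itv.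
by apply/seteqP; split => x xab i; [move=> _; exact: xab|exact: xab].
Qed.

Lemma measurable_box a b : measurable (box a b).
Proof. by apply: closed_rV_measurable; exact: box_closed. Qed.

(** The map $x \mapsto c + r x$ sends a box cover of [A] to a box cover of [B] and multiplies each
    volume by $r^d$. *)
Lemma lebesgue_d_affine (A B : set V) (c : V) (r : R) : 0 < r ->
  (forall x, B x -> A (r^-1 *: (x - c))) ->
  (lebesgue_d B <= (r ^+ d)%:E * lebesgue_d A)%E.
Proof.
move=> r0 BA; rewrite -lee_pdivrMl ?exprn_gt0//.
apply: le_ereal_inf_tmp => _ [[a b] /= [ab Aab] <-].
rewrite lee_pdivrMl ?exprn_gt0// -nneseriesZl; last first.
  by move=> k _; rewrite lee_fin boxvol_ge0.
apply: ereal_inf_lbound; exists (fun k => c + r *: a k, fun k => c + r *: b k) => /=.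
  split=> [k i|x /BA /Aab [k _ H]].
    by rewrite !mxE lerD2l ler_pM2l.
  exists k => // i; have := H i; rewrite !mxE.
  by rewrite ler_pdivlMl// ler_pdivrMl// => /andP[? ?]; lra.
apply: eq_eseriesr => k _; rewrite -EFinM; congr EFin.
rewrite /boxvol -[X in r ^+ X]card_ord -prodr_const -big_split/=.
by apply: eq_bigr => i _; rewrite !mxE; ring.
Qed.

End box_covers.

(** * The box-cover outer measure as a Borel measure *)

Section lebesgue_outer.
Context {R : realType} {d : nat}.
Local Notation V := 'rV[R]_d.+1.
Local Notation L := (@lebesgue_d R d.+1).

(** The box is followed by degenerate boxes at the origin, of volume zero because the dimension is
    positive. In dimension 0 every box has volume 1, hence the [d.+1] of this section. *)
Lemma lebesgue_d_box_le (a b : V) : (forall i, a 0 i <= b 0 i) ->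
  (L (box a b) <= (boxvol a b)%:E)%E.
Proof.
move=> ab; apply: ereal_inf_lbound.
exists (fun k => if k is 0%N return V then a else 0,
  fun k => if k is 0%N return V then b else 0).
  by split=> [[|k] i//|x xab]; exists 0%N.
rewrite /= nneseries_recl//; last first.
  by move=> [|k] _; rewrite lee_fin boxvol_ge0// => i.
rewrite eseries_cond/= eseries0 ?adde0// => -[|k]//= _ _.
by rewrite /boxvol big_ord_recl mxE subrr mul0r.
Qed.

Lemma lebesgue_d_set0 : L set0 = 0%E.
Proof.
apply/eqP; rewrite eq_le lebesgue_d_ge0 andbT.
have /le_trans -> // : (L set0 <= L (box 0 0))%E by exact: le_lebesgue_d.
rewrite (le_trans (lebesgue_d_box_le _ _ _))//.
by rewrite /boxvol big_ord_recl mxE subrr mul0r.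
Qed.

(** Cover [A n] up to $\varepsilon / 2^{n+1}$ and list the doubly indexed boxes as one sequence. *)
Lemma lebesgue_d_sigma_subadditive : sigma_subadditive L.
Proof.
move=> A; have [[i Aioo]|] := pselect (exists i, L (A i) = +oo%E).
  by rewrite (eseries_pinfty _ _ Aioo) ?leey// => n _;
    rewrite gt_eqF// (lt_le_trans _ (lebesgue_d_ge0 _)).
move=> /forallNP Aoo; apply/lee_addgt0Pr => e e0.
apply: le_trans (epsilon_trick _ _ (ltW e0)) => [|n]; last exact: lebesgue_d_ge0.
have H n : exists ab : (nat -> V) * (nat -> V),
    [/\ forall k i, ab.1 k 0 i <= ab.2 k 0 i,
        A n `<=` \bigcup_k box (ab.1 k) (ab.2 k) &
        (\sum_(k <oo) (boxvol (ab.1 k) (ab.2 k))%:E <=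
          L (A n) + (e / (2 ^ n.+1)%:R)%:E)%E].
  have en : 0 < e / (2 ^ n.+1)%:R by rewrite divr_gt0// ltr0n expn_gt0.
  have fA : L (A n) \is a fin_num.
    by rewrite ge0_fin_numE ?lebesgue_d_ge0// ltey; exact/eqP/Aoo.
  have [_ [ab [ab1 ab2] <-] abe] := lb_ereal_inf_adherent en fA.
  by exists ab; split => //; exact: ltW.
have [G HG] := choice H.
pose v (p : nat * nat) := (boxvol ((G p.1).1 p.2) ((G p.1).2 p.2))%:E.
have v0 p : (0 <= v p)%E.
  by rewrite lee_fin boxvol_ge0// => i; have [] := HG p.1.
apply: (@le_trans _ _ (\sum_(i <oo) \sum_(j <oo) v (i, j))%E); last first.
  apply: lee_nneseries => [i _ _|i _]; first exact: nneseries_ge0.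
  by have [] := HG i.
(* The iterated series is read as an unordered sum over pairs, which a bijection from [nat] can
   reindex. *)
have -> : (\sum_(i <oo) \sum_(j <oo) v (i, j))%E = \esum_(p in setT) v p.
  rewrite nneseries_esumT; last by move=> i; exact: nneseries_ge0.
  under eq_esum do rewrite nneseries_esumT//.
  by rewrite esum_esum//; congr esum; apply/seteqP; split => -[].
have /card_esym/ppcard_eqP[f] := card_nat2.
rewrite (@reindex_esum _ _ _ setT setT f)//.
rewrite -nneseries_esumT//; apply: ereal_inf_lbound.
exists (fun k => (G (f k).1).1 (f k).2, fun k => (G (f k).1).2 (f k).2) => //=.
split=> [k i|x [n _ Anx]]; first by have [] := HG (f k).1.
have [_ /(_ _ Anx)[k _ xk] _] := HG n.
by exists (f^-1%FUN (n, k)) => //=; rewrite invK ?inE.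
Qed.

HB.instance Definition _ := isOuterMeasure.Build R V L lebesgue_d_set0
  lebesgue_d_ge0 le_lebesgue_d lebesgue_d_sigma_subadditive.

(* A hyperplane cuts a closed box into two closed boxes whose volumes add up. *)
Lemma lebesgue_d_halfspace (i : 'I_d.+1) (c : R) :
  L.-caratheodory [set x | x 0 i <= c].
Proof.
apply: le_caratheodory_measurable => X.
apply: le_ereal_inf_tmp => _ [[a b] /= [ab Xab] <-].
pose t k := Num.min (b k 0 i) (Num.max (a k 0 i) c).
have tab k : a k 0 i <= t k <= b k 0 i.
  by rewrite /t le_min ge_min le_max !lexx ab.
pose b' k : V := \row_j if j == i then t k else b k 0 j.
pose a' k : V := \row_j if j == i then t k else a k 0 j.
have volE k : boxvol (a k) (b k) =
    boxvol (a k) (b' k) + boxvol (a' k) (b k).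
  rewrite /boxvol (bigD1 i)//= [X in _ = X + _](bigD1 i)//=.
  rewrite [X in _ = _ + X](bigD1 i)//= /a' /b' !mxE eqxx.
  rewrite [X in _ = _ * X + _](eq_bigr (fun j => b k 0 j - a k 0 j)); last first.
    by move=> j /negbTE ji; rewrite !mxE ji.
  rewrite [X in _ = _ + _ * X](eq_bigr (fun j => b k 0 j - a k 0 j)); last first.
    by move=> j /negbTE ji; rewrite !mxE ji.
  by move: (\prod_(j | j != i) _) => p; ring.
have ab' k j : a k 0 j <= b' k 0 j.
  by rewrite /a' /b' mxE; case: eqP => // ->; have /andP[] := tab k.
have a'b k j : a' k 0 j <= b k 0 j.
  by rewrite /a' /b' mxE; case: eqP => // ->; have /andP[] := tab k.
under eq_eseriesr do rewrite volE EFinD.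
rewrite nneseriesD; [|by move=> *; rewrite lee_fin boxvol_ge0..].
apply: leeD; apply: ereal_inf_lbound.
- exists (a, b') => //; split => // x [/Xab[k _ xk] /= xc]; exists k => // j.
  have /andP[xa xb] := xk j; rewrite xa /b' mxE; case: eqP => //= ji.
  by rewrite ji in xb *; rewrite /t le_min le_max xb xc orbT.
- exists (a', b) => //; split => // x [/Xab[k _ xk] /= /negP]; rewrite -ltNge => xc.
  exists k => // j; have /andP[xa xb] := xk j; rewrite xb andbT /a' mxE.
  case: eqP => //= ji; rewrite ji in xa *.
  by rewrite /t ge_min ge_max xa (ltW xc) orbT.
Qed.

Lemma lebesgue_d_caratheodory : (measurable : set (set V)) `<=` L.-caratheodory.
Proof.
apply: rV_halfspace_borel; last exact: lebesgue_d_halfspace.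
split; first exact: caratheodory_measurable_set0.
  by move=> A mA; rewrite setTD; exact: caratheodory_measurable_setC.
by move=> F mF; exact: caratheodory_measurable_bigcup.
Qed.

Lemma lebesgue_d_semi_sigma_additive : semi_sigma_additive (L : set V -> \bar R).
Proof.
move=> F mF tF mUF; apply: (@caratheodory_measure_sigma_additive _ _ L) => //.
- by move=> n; exact: lebesgue_d_caratheodory.
- exact: lebesgue_d_caratheodory.
Qed.

(** From here on [lebesgue_d] is a measure on Borel sets, so that integration theory applies to
    integrals against it. *)
HB.instance Definition _ := isMeasure.Build _ V R L lebesgue_d_set0
  lebesgue_d_ge0 lebesgue_d_semi_sigma_additive.

End lebesgue_outer.

Section bigbox.
Context {R : realType} {d : nat}.
Local Notation V := 'rV[R]_d.

Definition bigbox (n : nat) : set V := box (const_mx (- n%:R)) (const_mx n%:R).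

Lemma nondecreasing_bigbox : nondecreasing_seq bigbox.
Proof.
move=> m n mn; apply/subsetPset => x xm i; have := xm i; rewrite !mxE.
by move=> /andP[xm1 xm2]; rewrite -(ler_nat R) in mn; apply/andP; split; lra.
Qed.

Lemma bigcup_bigbox : \bigcup_n bigbox n = setT.
Proof.
apply/seteqP; split => // x _.
exists (Num.truncn (\sum_i `|x 0 i|)).+1 => // i; rewrite !mxE -ler_norml.
apply: le_trans (ltW (truncnS_gt _)).
by rewrite (bigD1 i)//= lerDl sumr_ge0.
Qed.

Lemma measurable_bigbox n : measurable (bigbox n).
Proof. exact: measurable_box. Qed.

Lemma bigbox_const n i : (const_mx (- n%:R) : V) 0 i <= (const_mx n%:R : V) 0 i.
Proof. by rewrite !mxE; have := ler0n R n; lra. Qed.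

Lemma cvg_bigbox (m : {measure set V -> \bar R}) (A : set V) : measurable A ->
  m (A `&` bigbox n) @[n --> \oo] --> m A.
Proof.
move=> mA; rewrite -[X in _ --> m X](setIT A) -bigcup_bigbox setI_bigcupr.
apply: nondecreasing_cvg_mu.
- by move=> n; apply: measurableI => //; exact: measurable_bigbox.
- apply: bigcup_measurable => n _.
  by apply: measurableI => //; exact: measurable_bigbox.
- move=> n k nk; apply/subsetPset; apply: setIS; apply/subsetPset.
  exact: nondecreasing_bigbox.
Qed.

End bigbox.

(** The sums leave no slack, so neither inequality between the terms can be strict; finiteness
    permits the cancellation. *)
Lemma eq_of_leeD {R : realType} (x y z w : \bar R) :
  (x + y)%E \is a fin_num -> (z + w <= x + y)%E -> (x <= z)%E -> (y <= w)%E ->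
  z = x.
Proof.
case: x => [x| |]//; case: y => [y| |]//; case: z => [z| |]//; case: w => [w| |]//.
by move=> _; rewrite -!EFinD !lee_fin => *; congr EFin; lra.
Qed.

(** * Uniqueness of the Borel measure with prescribed box volumes *)

Section lebesgue_unique.
Context {R : realType} {d : nat}.
Local Notation V := 'rV[R]_d.+1.
Local Notation L := (@lebesgue_d R d.+1).
Variable m : {measure set V -> \bar R}.
Hypothesis mbox : forall a b : V, (forall i, a 0 i <= b 0 i) ->
  m (box a b) = (boxvol a b)%:E.

(** Each box cover of [A] bounds [m A] by countable subadditivity. *)
Lemma le_measure_lebesgue_d A : measurable A -> (m A <= L A)%E.
Proof.
move=> mA; apply: le_ereal_inf_tmp => _ [[a b] /= [ab Aab] <-].
under eq_eseriesr do rewrite -mbox//.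
apply: measure_sigma_subadditive => // k; exact: measurable_box.
Qed.

(* On a large box B, [m] and [L] have the same total mass and [m <= L] both on [A]
   and on [B `\` A], so equality holds throughout. *)
Lemma lebesgue_dE A : measurable A -> L A = m A.
Proof.
move=> mA; have mB n := @measurable_bigbox R d.+1 n.
have LAB n : L (A `&` bigbox n) = m (A `&` bigbox n).
  have mAB : measurable (A `&` bigbox n) by exact: measurableI.
  have mBA : measurable (bigbox n `\` A) by exact: measurableD.
  have splitB (k : {measure set V -> \bar R}) :
      k (bigbox n) = (k (A `&` bigbox n) + k (bigbox n `\` A))%E.
    by rewrite (measureDI k (mB n) mA) addeC setIC.
  have LB : (L (bigbox n) <= m (bigbox n))%E.
    by rewrite mbox; [apply: lebesgue_d_box_le|]; exact: bigbox_const.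
  have mfin : m (bigbox n) \is a fin_num by rewrite mbox//; exact: bigbox_const.
  rewrite (splitB m) in mfin LB; rewrite (splitB L) in LB.
  exact: (eq_of_leeD _ _ _ _ mfin LB (le_measure_lebesgue_d _ mAB)
    (le_measure_lebesgue_d _ mBA)).
have := cvg_bigbox m A mA; under eq_fun do rewrite -LAB.
by move=> /(cvg_unique _ (cvg_bigbox L A mA)); exact.
Qed.

End lebesgue_unique.

(** * Iterated product construction of Lebesgue measure *)

Section cons_row.
Context {R : realType} {d : nat}.
Local Notation V := 'rV[R]_d.

(** Identifies $\mathbb{R} \times \mathbb{R}^d$ with $\mathbb{R}^{d+1}$, so that Lebesgue measure
    can be built by induction on the dimension. *)
Definition cons_rV (p : R * V) : 'rV[R]_d.+1 :=
  \row_i oapp (p.2 0) p.1 (unlift ord0 i).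

Lemma cons_rV0 p : cons_rV p 0 ord0 = p.1.
Proof. by rewrite mxE unlift_none. Qed.

Lemma cons_rVS p i : cons_rV p 0 (lift ord0 i) = p.2 0 i.
Proof. by rewrite mxE liftK. Qed.

Lemma measurable_cons_rV : measurable_fun setT cons_rV.
Proof.
apply: measurable_rV_fun => i; case: (unliftP ord0 i) => [j|] ->.
  under eq_fun do rewrite cons_rVS.
  exact: (measurableT_comp (measurable_coord j) measurable_snd).
by under eq_fun do rewrite cons_rV0; exact: measurable_fst.
Qed.

Lemma preimage_cons_rV_box (a b : 'rV[R]_d.+1) :
  cons_rV @^-1` box a b = `[a 0 ord0, b 0 ord0]%classic `*`
    box (\row_i a 0 (lift ord0 i)) (\row_i b 0 (lift ord0 i)).
Proof.
apply/seteqP; split => -[x v] /= H.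
  split; first by have := H ord0; rewrite cons_rV0 in_itv.
  by move=> i; have := H (lift ord0 i); rewrite cons_rVS !mxE.
move=> i; case: (unliftP ord0 i) => [j|] ->.
  by have := H.2 j; rewrite cons_rVS !mxE.
by have := H.1; rewrite cons_rV0 /= in_itv.
Qed.

Lemma dotv_cons_rV p : dotv (cons_rV p) (cons_rV p) = p.1 ^+ 2 + dotv p.2 p.2.
Proof.
rewrite /dotv big_ord_recl cons_rV0 expr2; congr (_ + _).
by apply: eq_bigr => i _; rewrite cons_rVS.
Qed.

End cons_row.

Lemma measurable_dotv {R : realType} {d} :
  measurable_fun setT (fun x : 'rV[R]_d => dotv x x).
Proof.
by apply: measurable_sum => i; apply: measurable_funM; exact: measurable_coord.
Qed.

Lemma measurable_gauss_rV {R : realType} {d} :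
  measurable_fun setT (fun x : 'rV[R]_d => (expR (- dotv x x))%:E).
Proof.
apply/measurable_EFinP; apply: measurableT_comp => //.
by apply: measurable_funN; exact: measurable_dotv.
Qed.

Lemma sigma_finite_boxes {R : realType} {d} (m : {measure set 'rV[R]_d -> \bar R}) :
  (forall a b : 'rV[R]_d, (forall i, a 0 i <= b 0 i) ->
    m (box a b) = (boxvol a b)%:E) ->
  sigma_finite setT m.
Proof.
move=> mbox; exists bigbox; first by rewrite bigcup_bigbox.
move=> n; split; first exact: measurable_bigbox.
by rewrite mbox ?ltry//; exact: bigbox_const.
Qed.

Lemma pushforward_measure {d1 d2} {T1 : measurableType d1}
    {T2 : measurableType d2} {R : realType} (m : {measure set T1 -> \bar R})
    (f : T1 -> T2) : measurable_fun setT f ->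
  exists m' : {measure set T2 -> \bar R}, pushforward m f = m' :> (set T2 -> \bar R).
Proof. by move=> mf; unshelve eexists (pushforward m f). Qed.

Section cons_measure.
Context {R : realType} {d : nat}.
Variable m : {sigma_finite_measure set 'rV[R]_d -> \bar R}.
Hypothesis mbox : forall a b : 'rV[R]_d, (forall i, a 0 i <= b 0 i) ->
  m (box a b) = (boxvol a b)%:E.

Definition cons_measure : set 'rV[R]_d.+1 -> \bar R :=
  pushforward (@lebesgue_measure R \x m)%E cons_rV.

Let cons_measureE := pushforward_measure (@lebesgue_measure R \x m)%E _
  (@measurable_cons_rV R d).

Lemma cons_measure0 : cons_measure set0 = 0%E.
Proof. by have [m' mE] := cons_measureE; rewrite /cons_measure mE measure0. Qed.

Lemma cons_measure_ge0 A : (0 <= cons_measure A)%E.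
Proof. by have [m' mE] := cons_measureE; rewrite /cons_measure mE measure_ge0. Qed.

Lemma cons_measure_semi_sigma_additive : semi_sigma_additive cons_measure.
Proof.
by have [m' mE] := cons_measureE; rewrite /cons_measure mE;
  exact: measure_semi_sigma_additive.
Qed.

HB.instance Definition _ := isMeasure.Build _ _ _ cons_measure
  cons_measure0 cons_measure_ge0 cons_measure_semi_sigma_additive.

Lemma cons_measure_box (a b : 'rV[R]_d.+1) : (forall i, a 0 i <= b 0 i) ->
  cons_measure (box a b) = (boxvol a b)%:E.
Proof.
move=> ab; rewrite /cons_measure /pushforward preimage_cons_rV_box.
rewrite product_measure1E//; last exact: measurable_box.
rewrite mbox; last by move=> i; rewrite !mxE.
rewrite /= lebesgue_measure_itv/= lte_fin /boxvol big_ord_recl EFinM.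
have <- : (b 0 ord0 - a 0 ord0)%:E = (if (a 0 ord0 < b 0 ord0)%R
    then (b 0%R ord0)%:E - (a 0%R ord0)%:E else 0)%E.
  case: ltP => [_|ba]; first by rewrite EFinB.
  by congr EFin; have := ab ord0; lra.
by congr (_ * EFin _)%E; apply: eq_bigr => i _; rewrite !mxE.
Qed.

HB.instance Definition _ := Measure_isSigmaFinite.Build _ _ _ cons_measure
  (sigma_finite_boxes _ cons_measure_box).

End cons_measure.

(** By induction on the dimension: the product with Lebesgue measure on the line multiplies box
    volumes by side lengths, and by Tonelli it multiplies the Gaussian integral by $\sqrt{\pi}$. *)
Lemma exists_lebesgue_rV (R : realType) (d : nat) :
  exists m : {sigma_finite_measure set 'rV[R]_d -> \bar R},
    (forall a b : 'rV[R]_d, (forall i, a 0 i <= b 0 i) ->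
      m (box a b) = (boxvol a b)%:E) /\
    (\int[m]_x (expR (- dotv x x))%:E = (Num.sqrt pi ^+ d)%:E)%E.
Proof.
elim: d => [|d [m [mbox mgauss]]].
  (* In dimension 0 the space is a point, and each box has the empty product 1 as its volume. *)
  exists (\d_ (0 : 'rV[R]_0)); split=> [a b _|].
    rewrite /= diracE mem_set; last by case.
    by rewrite /boxvol big_ord0.
  rewrite integral_dirac//; last exact: measurable_gauss_rV.
  by rewrite diracT mul1e /dotv big_ord0 oppr0 expR0 expr0.
unshelve eexists (cons_measure m); first exact: mbox.
split => [|/=]; first exact: cons_measure_box.
transitivity (\int[(@lebesgue_measure R \x m)%E]_p
    (expR (- dotv (cons_rV p) (cons_rV p)))%:E)%E.
  have := @ge0_integral_pushforward _ _ (measurableTypeR R * 'rV[R]_d)%type _ R _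
    measurable_cons_rV
    (@lebesgue_measure R \x m)%E setT (fun x => (expR (- dotv x x))%:E).
  rewrite preimage_setT; apply=> //; exact: measurable_gauss_rV.
rewrite fubini_tonelli1//; last first.
  exact: (measurableT_comp measurable_gauss_rV measurable_cons_rV).
rewrite /fubini_F /=.
have inner (x : R) : (\int[m]_y (expR (- dotv (cons_rV (x, y)) (cons_rV (x, y))))%:E =
    (expR (- x ^+ 2))%:E * (Num.sqrt pi ^+ d)%:E)%E.
  rewrite -mgauss -ge0_integralZl_EFin//.
  - by apply: eq_integral => y _; rewrite dotv_cons_rV opprD expRD EFinM.
  - exact: measurable_gauss_rV.
under eq_integral do rewrite inner.
rewrite ge0_integralZr//.
- by rewrite (integralT_gauss (R := R)) -EFinM -exprS.
- by apply/measurable_EFinP; exact: measurable_gauss_fun.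
Qed.

(** * Euclidean norm and balls *)

Section euclidean_norm.
Context {R : realType} {d : nat}.
Implicit Types x y z : 'rV[R]_d.

Lemma dotv_ge0 x : 0 <= dotv x x.
Proof. by apply: sumr_ge0 => i _; rewrite -expr2 sqr_ge0. Qed.

Lemma enorm_ge0 x : 0 <= enorm x.
Proof. exact: sqrtr_ge0. Qed.

Lemma enorm_sqr x : enorm x ^+ 2 = dotv x x.
Proof. by rewrite sqr_sqrtr ?dotv_ge0. Qed.

Lemma dotvZ (r : R) x : dotv (r *: x) (r *: x) = r ^+ 2 * dotv x x.
Proof.
by rewrite /dotv mulr_sumr; apply: eq_bigr => i _; rewrite !mxE; ring.
Qed.

Lemma enormZ (r : R) x : 0 <= r -> enorm (r *: x) = r * enorm x.
Proof.
by move=> r0; rewrite /enorm dotvZ sqrtrM ?sqr_ge0// sqrtr_sqr ger0_norm.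
Qed.

Lemma coord_le_enorm x i : `|x 0 i| <= enorm x.
Proof.
rewrite -sqrtr_sqr ler_sqrt ?dotv_ge0// /dotv (bigD1 i)//= -expr2 lerDl.
by apply: sumr_ge0 => j _; rewrite -expr2 sqr_ge0.
Qed.

(** Cauchy-Schwarz: expanding $\sum_i (|y| x_i - |x| y_i)^2 \ge 0$ gives $2 |x| |y| (|x| |y| -
    \langle x, y \rangle) \ge 0$, and the factor can be divided out once the zero norms are treated
    apart. *)
Lemma le_dotv_enorm x y : dotv x y <= enorm x * enorm y.
Proof.
have [x0|x0] := eqVneq (enorm x) 0.
  rewrite x0 mul0r /dotv big1// => i _.
  have := coord_le_enorm x i; rewrite x0 normr_le0 => /eqP ->.
  by rewrite mul0r.
have [y0|y0] := eqVneq (enorm y) 0.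
  rewrite y0 mulr0 /dotv big1// => i _.
  have := coord_le_enorm y i; rewrite y0 normr_le0 => /eqP ->.
  by rewrite mulr0.
have {}x0 : 0 < enorm x by rewrite lt_neqAle eq_sym x0 enorm_ge0.
have {}y0 : 0 < enorm y by rewrite lt_neqAle eq_sym y0 enorm_ge0.
have : 0 <= \sum_i (enorm y * x 0 i - enorm x * y 0 i) ^+ 2.
  by apply: sumr_ge0 => i _; rewrite sqr_ge0.
have -> : \sum_i (enorm y * x 0 i - enorm x * y 0 i) ^+ 2 =
    2 * (enorm x * enorm y) * (enorm x * enorm y - dotv x y).
  rewrite (eq_bigr (fun i => enorm y ^+ 2 * (x 0 i * x 0 i) +
      enorm x ^+ 2 * (y 0 i * y 0 i) - 2 * (enorm x * enorm y) * (x 0 i * y 0 i))).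
    rewrite sumrB big_split/= -!mulr_sumr -/(dotv x x) -/(dotv y y) -/(dotv x y).
    by rewrite -!enorm_sqr; ring.
  by move=> i _; ring.
by rewrite pmulr_rge0 ?subr_ge0// !mulr_gt0.
Qed.

Lemma enormD x y : enorm (x + y) <= enorm x + enorm y.
Proof.
rewrite -[leRHS]ger0_norm ?addr_ge0 ?enorm_ge0// -sqrtr_sqr ler_sqrt ?sqr_ge0//.
rewrite sqrrD !enorm_sqr.
have -> : dotv (x + y) (x + y) = dotv x x + dotv x y *+ 2 + dotv y y.
  rewrite /dotv -sumrMnl -!big_split/=.
  by apply: eq_bigr => i _; rewrite mxE; ring.
by rewrite lerD2r lerD2l lerMn2r le_dotv_enorm orbT.
Qed.

Lemma enormN x : enorm (- x) = enorm x.
Proof.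
by congr Num.sqrt; apply: eq_bigr => i _; rewrite !mxE mulrNN.
Qed.

Lemma enorm_ltE x (t : R) : 0 < t -> (enorm x < Num.sqrt t) = (dotv x x < t).
Proof. by move=> t0; rewrite ltr_sqrt. Qed.

Lemma enorm_le_sum x : enorm x <= \sum_i `|x 0 i|.
Proof.
rewrite -[leRHS]ger0_norm ?sumr_ge0// -sqrtr_sqr ler_sqrt ?sqr_ge0//.
rewrite expr2 mulr_suml; apply: ler_sum => i _.
rewrite -expr2 -(real_normK (num_real _)) expr2 ler_wpM2l//.
by rewrite (bigD1 i)//= lerDl sumr_ge0.
Qed.

Lemma measurable_enorm : measurable_fun setT (@enorm R d).
Proof.
have ms : measurable_fun setT (@Num.sqrt R).
  by apply: continuous_measurable_fun; exact: sqrt_continuous.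
exact: (measurableT_comp ms measurable_dotv).
Qed.

Lemma measurable_rV_sub (c : 'rV[R]_d) : measurable_fun setT (fun x : 'rV[R]_d => x - c).
Proof.
apply: measurable_rV_fun => i; under eq_fun do rewrite !mxE.
by apply: measurable_funD => //; exact: measurable_coord.
Qed.

Lemma measurable_eball (c : 'rV[R]_d) (r : R) : measurable (eball c r).
Proof.
rewrite (_ : eball c r = setT `&` (fun x => enorm (x - c)) @^-1` `]-oo, r[%classic).
  apply: (measurableT_comp measurable_enorm (measurable_rV_sub c)) => //.
by rewrite setTI; apply/seteqP; split => x /=; rewrite in_itv.
Qed.

End euclidean_norm.

Section ball_volume.
Context {R : realType} {d : nat}.
Local Notation V := 'rV[R]_d.+1.
Local Notation L := (@lebesgue_d R d.+1).

(** The affine bound is applied to the dilation of the unit ball onto [eball c t] and to its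
    inverse. *)
Lemma lebesgue_d_eball_scale (c : V) (t : R) : 0 < t ->
  L (eball c t) = ((t ^+ d.+1)%:E * L (eball 0 1))%E.
Proof.
move=> t0; apply/eqP; rewrite eq_le; apply/andP; split.
  apply: (lebesgue_d_affine _ _ c _ t0) => x; rewrite /eball/= subr0 => xt.
  by rewrite enormZ ?invr_ge0 ?ltW// ltr_pdivrMl// mulr1.
rewrite -lee_pdivlMl ?exprn_gt0// -exprVn.
(* The map $x \mapsto t x + c$ is $r^{-1} (x - c')$ with $r = t^{-1}$ and $c' = - t^{-1} c$. *)
have := @lebesgue_d_affine R d.+1 (eball c t) (eball 0 1) (- (t^-1 *: c)) t^-1.
rewrite invr_gt0 invrK; apply => // x; rewrite /eball/= subr0 => x1.
rewrite opprK scalerDr scalerA divff ?gt_eqF// scale1r addrK.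
by rewrite enormZ ?ltW// gtr_pMr.
Qed.

Lemma lebesgue_d_eball1_lty : (L (eball 0 1) < +oo)%E.
Proof.
have H i : (const_mx (- 1) : V) 0 i <= (const_mx 1 : V) 0 i by rewrite !mxE; lra.
apply: (@le_lt_trans _ _ (L (box (const_mx (- 1)) (const_mx 1)))).
  apply: le_lebesgue_d => x; rewrite /eball/= subr0 => x1 i; rewrite !mxE.
  by rewrite -ler_norml (le_trans (coord_le_enorm x i))// ltW.
by apply: le_lt_trans (lebesgue_d_box_le _ _ H) _; rewrite ltry.
Qed.

End ball_volume.

(** With $a = |x|^2$ this writes the Gaussian as an integral over the levels $t > |x|^2$; an
    antiderivative is $-e^{-t}$. *)
Lemma integral_expRN {R : realType} (a : R) :
  (\int[lebesgue_measure]_(t in `]a, +oo[) (expR (- t))%:E = (expR (- a))%:E)%E.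
Proof.
have cN : continuous (fun t : R => expR (- t)).
  move=> x; apply: (@continuous_comp _ _ _ -%R expR); last exact: continuous_expR.
  exact: opp_continuous.
rewrite integral_itv_obnd_cbnd; last first.
  by apply/measurable_EFinP/measurable_funTS; exact: continuous_measurable_fun.
rewrite (@ge0_continuous_FTC2y _ _ (fun t => - expR (- t)) a 0).
- by rewrite EFinN oppeK add0e.
- by move=> t _; exact: expR_ge0.
- exact: continuous_subspaceT.
- by rewrite -oppr0; apply: cvgN; exact: cvgr_expR.
- by move=> x _; exact: ex_derive.
- by apply: cvgN; apply/cvg_at_right_filter; exact: cN.
- move=> x _; rewrite derive1E.
  by rewrite derive_val; rewrite /GRing.scale/=; ring.
Qed.

(** * Volume of the unit ball *)

Section layer_cake.
Context {R : realType} {d : nat}.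
Local Notation V := 'rV[R]_d.
Variable m : {sigma_finite_measure set V -> \bar R}.

(* Integrate [exp (-t)] over the region [|x|^2 < t] of ['rV_d * R] in both orders. *)
Lemma gauss_layer_cake :
  (\int[m]_x (expR (- dotv x x))%:E =
   \int[lebesgue_measure]_t ((expR (- t))%:E * m [set x | (dotv x x < t)%R]))%E.
Proof.
pose E : set (V * measurableTypeR R) := [set p | dotv p.1 p.1 < p.2].
have mE : measurable E.
  rewrite (_ : E = setT `&` (fun p => dotv p.1 p.1 - p.2) @^-1` `]-oo, 0[%classic).
    apply: measurable_funB => //; first exact: (measurableT_comp measurable_dotv).
  by rewrite setTI; apply/seteqP; split => p; rewrite /E/= in_itv/= subr_lt0.
pose f (p : V * measurableTypeR R) := (expR (- p.2) * \1_E p)%:E.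
have mexp : measurable_fun setT (fun t : R => expR (- t)).
  by apply: continuous_measurable_fun => x; apply: (@continuous_comp _ _ _ -%R expR);
    [exact: opp_continuous|exact: continuous_expR].
have mf : measurable_fun setT f.
  apply/measurable_EFinP; apply: measurable_funM; last exact: measurable_indic.
  exact: (measurableT_comp mexp measurable_snd).
have f0 p : (0 <= f p)%E by rewrite lee_fin mulr_ge0 ?expR_ge0.
have := @fubini_tonelli _ _ _ _ R m (@lebesgue_measure R) f mf f0.
rewrite (_ : (\int[m]_x _ = \int[m]_x (expR (- dotv x x))%:E)%E); last first.
  apply: eq_integral => x _; rewrite -integral_expRN [RHS]integral_mkcond.
  apply: eq_integral => t _; rewrite /f patchE indicE.
  have -> : ((x, t) \in E) = (t \in `]dotv x x, +oo[%classic).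
    by apply/idP/idP; rewrite !inE /E/= in_itv/= andbT.
  by case: ifPn; rewrite ?mulr1 ?mulr0.
move=> ->; apply: eq_integral => t _.
have mEt : measurable [set x : V | dotv x x < t].
  rewrite (_ : mkset _ = setT `&` (fun x : V => dotv x x) @^-1` `]-oo, t[%classic).
    exact: measurable_dotv.
  by rewrite setTI; apply/seteqP; split => p; rewrite /= in_itv.
under eq_integral => x _ do rewrite /f/= EFinM.
rewrite ge0_integralZl_EFin ?expR_ge0//; last first.
  apply/measurable_EFinP.
  exact: (measurableT_comp (measurable_indic mE) (measurable_pair2 t)).
congr (_ * _)%E; rewrite -[X in m X]setIT -integral_indic//.
Qed.

End layer_cake.

Section unit_ball.
Context {R : realType} {d : nat}.
Local Notation V := 'rV[R]_d.+1.
Local Notation L := (@lebesgue_d R d.+1).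

Lemma sqrt_exprn (t : R) n : 0 <= t -> Num.sqrt t ^+ n = t `^ (n%:R / 2).
Proof.
by move=> t0; rewrite mulrC powRrM powR12_sqrt// powR_mulrn// sqrtr_ge0.
Qed.

(** For $t > 0$ the layer $|x|^2 < t$ is a ball of radius $\sqrt{t}$, whose volume is $t^{(d+1)/2}$
    times that of the unit ball. The Gamma integral stays in the extended reals, as its finiteness
    is not known yet. *)
Lemma unit_ball_Gamma :
  ((pi `^ (d.+1%:R / 2))%:E = L (eball 0 1) *
    \int[lebesgue_measure]_(t in `]0%R, +oo[)
      (t `^ (d.+1%:R / 2) * expR (- t))%:E)%E.
Proof.
have [m [mbox mgauss]] := exists_lebesgue_rV R d.+1.
have LE := lebesgue_dE m mbox.
rewrite -sqrt_exprn ?pi_ge0// -mgauss gauss_layer_cake.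
have [v v0 vE] : exists2 v : R, 0 <= v & L (eball 0 1) = v%:E.
  exists (fine (L (eball 0 1))); first exact/fine_ge0/lebesgue_d_ge0.
  by rewrite fineK// ge0_fin_numE ?lebesgue_d_ge0//; exact: lebesgue_d_eball1_lty.
rewrite vE -ge0_integralZl_EFin//; last first.
- apply/measurable_EFinP/measurable_funTS; apply: measurable_funM.
    exact: measurable_powR.
  by apply: continuous_measurable_fun => x; apply: (@continuous_comp _ _ _ -%R expR);
    [exact: opp_continuous|exact: continuous_expR].
- by move=> t _; rewrite lee_fin mulr_ge0 ?powR_ge0 ?expR_ge0.
rewrite [RHS]integral_mkcond; apply: eq_integral => t _; rewrite patchE.
case: ifPn => [|/negP].
  rewrite inE/= in_itv/= andbT => t0.
  rewrite (_ : [set x | _] = eball (0 : V) (Num.sqrt t)); last first.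
    by apply/seteqP; split => x; rewrite /eball/= subr0 enorm_ltE.
  rewrite -LE; last exact: measurable_eball.
  rewrite lebesgue_d_eball_scale ?sqrtr_gt0// vE sqrt_exprn ?ltW//.
  by rewrite -!EFinM; congr EFin; ring.
(* For $t \le 0$ the layer is empty. *)
rewrite inE/= in_itv/= andbT => /negP; rewrite -leNgt => t0.
rewrite (_ : [set x | _] = set0) ?measure0 ?mule0//.
apply/seteqP; split => x //=; apply/negP; rewrite -leNgt.
by rewrite (le_trans t0)// dotv_ge0.
Qed.

(** [Gamma] goes through [fine], so an infinite integral would read as 0 and make the quotient 0.
    The layer identity excludes this, since its left side is finite and positive; it likewise
    excludes a zero integral. *)
Lemma omega_d_gt0 : 0 < omega_d R d.+1.
Proof.
have := unit_ball_Gamma; rewrite /omega_d /Gamma.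
have p0 : 0 < pi `^ (d.+1%:R / 2) :> R by rewrite powR_gt0 ?pi_gt0.
have G0 : (0 <= \int[lebesgue_measure]_(t in `]0%R, +oo[)
      (t `^ (d.+1%:R / 2) * expR (- t))%:E :> \bar R)%E.
  by apply: integral_ge0 => t _; rewrite lee_fin mulr_ge0 ?powR_ge0 ?expR_ge0.
rewrite addrK; move: G0; case: integral => [g| |]//= g0.
  rewrite lee_fin in g0.
  have := lebesgue_d_ge0 (eball 0 1 : set V); have := @lebesgue_d_eball1_lty R d.
  case: lebesgue_d => [v| |]//= _ v0 [] pE.
  rewrite divr_gt0// lt_neqAle g0 andbT; apply/eqP => g00.
  by rewrite pE -g00 mulr0 ltxx in p0.
have := lebesgue_d_ge0 (eball 0 1 : set V); have := @lebesgue_d_eball1_lty R d.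
case: lebesgue_d => [v| |]//= _ v0.
have [->|v0'] := eqVneq v 0; first by rewrite mul0e => -[] pE; rewrite pE ltxx in p0.
by rewrite gt0_muley// lte_fin lt_neqAle eq_sym v0'.
Qed.

(** Positivity of [omega_d] forces the Gamma integral to be finite and nonzero, so the layer
    identity can be divided by it. *)
Lemma lebesgue_d_unit_ball : L (eball 0 1) = (omega_d R d.+1)%:E.
Proof.
have := omega_d_gt0; have := unit_ball_Gamma; rewrite /omega_d /Gamma addrK.
have p0 : 0 < pi `^ (d.+1%:R / 2) :> R by rewrite powR_gt0 ?pi_gt0.
case: integral => [g| |]//=; rewrite ?invr0 ?mulr0 ?ltxx//.
have := lebesgue_d_ge0 (eball 0 1 : set V); have := @lebesgue_d_eball1_lty R d.
case: lebesgue_d => [v| |]//= _ v0 [] -> g0; congr EFin.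
rewrite mulfK//; apply: contraTN g0 => /eqP ->.
by rewrite invr0 mulr0 ltxx.
Qed.

Lemma lebesgue_d_eball (c : V) (t : R) : 0 < t ->
  L (eball c t) = (omega_d R d.+1 * t ^+ d.+1)%:E.
Proof.
by move=> t0; rewrite lebesgue_d_eball_scale// lebesgue_d_unit_ball mulrC EFinM.
Qed.

End unit_ball.

(** * Mass of tubes around a Lipschitz graph *)

Lemma measurable_rV_sub2 {R : realType} {d} :
  measurable_fun setT (fun z : 'rV[R]_d * 'rV[R]_d => z.1 - z.2).
Proof.
apply: measurable_rV_fun => i; under eq_fun do rewrite !mxE.
by apply: measurable_funB; apply: (measurableT_comp (measurable_coord i)).
Qed.

Section density_bound.
Context {R : realType} {d : nat}.
Local Notation V := 'rV[R]_d.+1.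
Variables (nu : probability V R) (rho : V -> R) (lam : R).
Hypothesis mrho : measurable_fun setT rho.
Hypothesis rho_ge0 : forall y, 0 <= rho y.
Hypothesis nuE : forall A : set V, measurable A ->
  nu A = (\int[@lebesgue_d R d.+1]_(y in A) (rho y)%:E)%E.
Hypothesis rho_le : forall y, mspt nu y -> rho y <= lam.

Lemma mspt_rV_nonempty {n} (m : probability 'rV[R]_n R) : mspt m !=set0.
Proof.
apply/set0P/negP => /eqP m0; have := mspt_rV_full m.
by rewrite m0 measure0 => /eqP; rewrite eqe eq_sym oner_eq0.
Qed.

Lemma density_bound_ge0 : 0 <= lam.
Proof.
have [y yS] := mspt_rV_nonempty nu.
by rewrite (le_trans (rho_ge0 y))// rho_le.
Qed.

(** The density is bounded only on the support, so [A] is first cut down to the support, which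
    carries all of [nu]. *)
Lemma measure_le_density (A : set V) : measurable A ->
  (nu A <= lam%:E * lebesgue_d A)%E.
Proof.
move=> mA; have mS : measurable (mspt nu).
  by apply: closed_rV_measurable; exact: mspt_closed.
have -> : nu A = nu (A `&` mspt nu).
  rewrite [LHS](measureDI nu mA mS) -[RHS]add0e; congr (_ + _)%E.
  apply: (@subset_measure0 _ _ _ _ _ (~` mspt nu)) => //.
  - exact: measurableD.
  - exact: measurableC.
  - by rewrite [LHS]probability_setC// mspt_rV_full subee.
rewrite nuE; last exact: measurableI.
apply: (@le_trans _ _ (\int[@lebesgue_d R d.+1]_(y in A `&` mspt nu) (lam%:E))%E).
  apply: ge0_le_integral => //.
  - exact: measurableI.
  - by move=> y _; rewrite lee_fin.
  - by apply/measurable_EFinP; exact: measurable_funTS.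
  - by move=> y [_ /rho_le]; rewrite lee_fin.
rewrite integral_cst; last exact: measurableI.
rewrite lee_wpmul2l ?lee_fin ?density_bound_ge0//.
by apply: le_lebesgue_d; exact: subIsetl.
Qed.

Lemma measure_eball_le (c : V) (t : R) : 0 < t ->
  (nu (eball c t) <= (lam * (omega_d R d.+1 * t ^+ d.+1))%:E)%E.
Proof.
move=> t0; rewrite EFinM -(lebesgue_d_eball c t t0).
exact: measure_le_density (measurable_eball c t).
Qed.

(** The unit ball has mass 1, at most [lam] times its volume, so [lam] cannot vanish. *)
Lemma density_bound_gt0 : mspt nu `<=` eball 0 1 -> 0 < lam.
Proof.
move=> nuB; have := measure_eball_le 0 1 ltr01.
have : (nu (mspt nu) <= nu (eball 0 1))%E.
  apply: le_measure => //; rewrite inE; last exact: measurable_eball.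
  by apply: closed_rV_measurable; exact: mspt_closed.
rewrite mspt_rV_full => /le_trans/[apply]; rewrite lee_fin => h.
rewrite lt_neqAle density_bound_ge0 andbT; apply/eqP => lam0.
by move: h; rewrite -lam0 mul0r ler10.
Qed.

End density_bound.

Section tube.
Context {R : realType} {d : nat}.
Local Notation V := 'rV[R]_d.
Variables (T : V -> V) (L : R).
Hypothesis L0 : 0 <= L.
Hypothesis Tlip : forall x y, enorm (T x - T y) <= L * enorm (x - y).

Lemma measurable_lipschitz : measurable_fun setT T.
Proof.
apply: measurable_rV_fun => i.
apply: (measurability _ (measurable_realfun.RGenOInfty.measurableE R)).
move=> _ [_ [a ->] <-]; rewrite setTI.
rewrite (_ : _ @^-1` _ = [set x : V | a < T x 0 i]); last first.
  by apply/seteqP; split => x /=; rewrite in_itv/= andbT.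
apply: open_rV_measurable; rewrite openE => x /= xa.
(* A sup-norm ball of radius [e] has Euclidean radius at most [d * e], so [T] moves by at most
   [L * d * e]; the added 1 makes this strictly less than the gap and keeps the denominator
   positive. *)
pose e := (T x 0 i - a) / (L * d%:R + 1).
have Ld0 : 0 < L * d%:R + 1 by rewrite ltr_wpDl// mulr_ge0.
have e0 : 0 < e by rewrite divr_gt0// subr_gt0.
apply/nbhs_ballP; exists e => //= y /rV_ballP[_ xy].
have : `|T x 0 i - T y 0 i| <= L * (d%:R * e).
  rewrite (_ : T x 0 i - T y 0 i = (T x - T y) 0 i); last by rewrite !mxE.
  rewrite (le_trans (coord_le_enorm _ _))// (le_trans (Tlip _ _))// ler_wpM2l//.
  rewrite (le_trans (enorm_le_sum _))//.
  rewrite (_ : d%:R * e = \sum_(i < d) e); last by rewrite sumr_const card_ord mulr_natl.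
  by apply: ler_sum => j _; have := xy j; rewrite !mxE => /ltW.
rewrite ler_norml => /andP[_ h].
have : e * (L * d%:R + 1) = T x 0 i - a by rewrite divfK// gt_eqF.
have -> : e * (L * d%:R + 1) = L * (d%:R * e) + e by ring.
by rewrite /=; lra.
Qed.

Definition tube (r : R) : set (V * V) := [set z | enorm (z.2 - T z.1) < r].

Lemma measurable_tube r : measurable (tube r).
Proof.
rewrite (_ : tube r = setT `&`
    (fun z => enorm (z.2 - T z.1)) @^-1` `]-oo, r[%classic); last first.
  by rewrite setTI; apply/seteqP; split => x; rewrite /tube/= in_itv.
apply: (measurableT_comp measurable_enorm) => //.
apply: (measurableT_comp (f := fun z : V * V => z.1 - z.2)
  (g := fun z : V * V => (z.2, T z.1))); first exact: measurable_rV_sub2.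
apply/measurable_fun_pairP; split; first exact: measurable_snd.
exact: (measurableT_comp measurable_lipschitz measurable_fst).
Qed.

(** The section of the tube over [x] is the ball of radius [r] around [T x], and [mu] has mass 1. *)
Lemma product_tube_le (mu nu : probability V R) (r k : R) :
  (forall c, nu (eball c r) <= k%:E)%E -> ((mu \x nu)%E (tube r) <= k%:E)%E.
Proof.
move=> nuk; have mt := measurable_tube r.
apply: (@le_trans _ _ (\int[mu]_x k%:E)%E).
  rewrite /product_measure1; apply: ge0_le_integral => //.
  - exact: measurable_fun_xsection.
  - move=> x _; rewrite /=.
    rewrite (_ : xsection _ _ = eball (T x) r)//.
    by apply/seteqP; split => y; rewrite /xsection/= inE.
by rewrite integral_cst//= probability_setT mule1.
Qed.

(** If $(x', T x')$ is within [r] of $(x, y)$, then $|y - T x| \le |y - T x'| + L |x - x'|$, and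
    Cauchy-Schwarz in the plane gives the factor $\sqrt{1 + L^2}$. *)
Lemma hdist_tube (A : set (V * V)) (c : R) : A !=set0 ->
  (hdist A (graph_of T) < c%:E)%E ->
  exists2 r, 0 < r < c & A `<=` tube (Num.sqrt (1 + L ^+ 2) * r).
Proof.
move=> [a Aa] hc.
have hle a' : A a' ->
    (ereal_inf [set (pdist a' b)%:E | b in graph_of T] <= hdist A (graph_of T))%E.
  by move=> Aa'; apply: ereal_sup_ubound; exists a'.
have h0 : (0 <= hdist A (graph_of T))%E.
  apply: le_trans (hle _ Aa); apply: le_ereal_inf_tmp => _ [b _ <-].
  by rewrite lee_fin sqrtr_ge0.
have [h hE] : exists h, hdist A (graph_of T) = h%:E.
  exists (fine (hdist A (graph_of T))); rewrite fineK// ge0_fin_numE//.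
  by apply: lt_le_trans hc _; rewrite leey.
rewrite hE !(lte_fin, lee_fin) in hc h0.
(* The midpoint is positive and strictly above [h], so every point of [A] has a graph point strictly
   within this radius. *)
exists ((h + c) / 2); first lra.
move=> [x y] Axy; rewrite /tube/=.
have : (ereal_inf [set (pdist (x, y) b)%:E | b in graph_of T] < ((h + c) / 2)%:E)%E.
  by apply: le_lt_trans (hle _ Axy) _; rewrite hE lte_fin; lra.
move=> /ereal_inf_lt[_ [_ [x' _ <-] <-]]; rewrite lte_fin /pdist/=.
have -> : (h + c) / 2 = Num.sqrt (((h + c) / 2) ^+ 2).
  by rewrite sqrtr_sqr ger0_norm//; lra.
rewrite ltr_sqrt ?exprn_gt0//; last lra.
set al := enorm (x - x'); set be := enorm (y - T x') => H.
have xT : enorm (y - T x) <= be + L * al.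
  rewrite -[y - T x](subrKA (T x')) (le_trans (enormD _ _))// lerD2l.
  by rewrite (le_trans (Tlip _ _))// -enormN opprB.
apply: le_lt_trans xT _; rewrite -sqrtrM; last by have := sqr_ge0 L; lra.
have al0 : 0 <= al by exact: enorm_ge0.
have be0 : 0 <= be by exact: enorm_ge0.
have LH : 0 < 1 + L ^+ 2 by have := sqr_ge0 L; lra.
rewrite -[ltLHS]ger0_norm; last by rewrite addr_ge0// mulr_ge0.
rewrite -sqrtr_sqr ltr_sqrt; last by rewrite mulr_gt0// exprn_gt0//; lra.
(* Cauchy-Schwarz for $(1, L)$ and [(be, al)]; its defect is the square $(al - L \, be)^2$. *)
apply: (@le_lt_trans _ _ ((1 + L ^+ 2) * (al ^+ 2 + be ^+ 2))).
  by rewrite -subr_ge0 (_ : _ - _ = (al - L * be) ^+ 2) ?sqr_ge0//; ring.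
by rewrite ltr_pM2l.
Qed.

End tube.

(** * Values of the transport problems *)

(* Integrate [f <= (f^2 / M + M) / 2] over [S]. *)
Lemma density_mass_bound {R : realType} {dT} {X : measurableType dT}
    (p P : probability X R) (f : X -> R) (S : set X) (M k : R) :
  measurable_fun setT f -> (forall z, 0 <= f z) ->
  (forall A, measurable A -> p A = (\int[P]_(z in A) (f z)%:E)%E) ->
  measurable S -> p S = 1%E -> (P S <= k%:E)%E -> 0 < M ->
  (\int[P]_z ((f z) ^+ 2)%:E <= M%:E)%E -> 1 <= M * k.
Proof.
move=> mf f0 pE mS pS Pk M0 fM.
have mf2 D : measurable_fun D (fun z => ((f z) ^+ 2)%:E).
  by apply/measurable_EFinP/measurable_funTS; apply: measurable_funX.
have f20 z : (0 <= ((f z) ^+ 2)%:E)%E by rewrite lee_fin sqr_ge0.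
have Mn0 : M != 0 by rewrite gt_eqF.
have iM : 0 <= (2 * M)^-1 by rewrite invr_ge0 mulr_ge0// ltW.
have : (p S <= \int[P]_(z in S) ((2 * M)^-1%:E * ((f z) ^+ 2)%:E + (M / 2)%:E))%E.
  rewrite pE//; apply: ge0_le_integral => //.
  - by move=> z _; rewrite lee_fin.
  - by apply/measurable_EFinP/measurable_funTS.
  - apply: emeasurable_funD => //; exact: measurable_funeM.
  - move=> z _; rewrite -EFinM -EFinD lee_fin -subr_ge0.
    move: (f z) => y.
    have -> : (2 * M)^-1 * y ^+ 2 + M / 2 - y = (2 * M)^-1 * (y - M) ^+ 2 by field.
    by rewrite mulr_ge0 ?sqr_ge0.
rewrite pS ge0_integralD//; last first.
- by move=> z _; rewrite lee_fin; lra.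
- exact: emeasurable_funM.
- by move=> z _; rewrite mule_ge0.
rewrite ge0_integralZl_EFin// integral_cst//.
have fS : (\int[P]_(z in S) ((f z) ^+ 2)%:E <= M%:E)%E.
  by apply: le_trans fM; apply: ge0_subset_integral.
move=> h; have : (1 <= (2 * M)^-1%:E * M%:E + (M / 2)%:E * k%:E :> \bar R)%E.
  apply: le_trans h _; apply: leeD; first by rewrite lee_wpmul2l.
  by rewrite lee_wpmul2l// lee_fin; lra.
rewrite -!EFinM -EFinD lee_fin (_ : (2 * M)^-1 * M = 2^-1); last by field; rewrite Mn0.
by lra.
Qed.

Lemma measurable_cost {R : realType} {d} : measurable_fun setT (@cost R d).
Proof.
apply: measurable_funM => //; apply: measurable_funX.
exact: (measurableT_comp measurable_enorm measurable_rV_sub2).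
Qed.

Lemma cost_ge0 {R : realType} {d} z : 0 <= @cost R d z.
Proof. by rewrite mulr_ge0 ?sqr_ge0. Qed.

Section values.
Context {R : realType} {d : nat}.
Local Notation V := 'rV[R]_d.
Variables (mu nu : probability V R).
Local Notation P := (mu \x nu)%E.
Local Notation EP := (\int[P]_z (cost z)%:E)%E.

Lemma OT_ge0 : (0 <= OT mu nu)%E.
Proof.
apply: le_ereal_inf_tmp => _ [p _ <-].
by apply: integral_ge0 => z _; rewrite lee_fin cost_ge0.
Qed.

Lemma couplings_product : couplings mu nu P.
Proof.
move=> A mA; split; rewrite [LHS]product_measure1E//.
  by rewrite [X in (_ * X)%E]probability_setT mule1.
by rewrite [X in (X * _)%E]probability_setT mul1e.
Qed.

Lemma OT_le_product : (OT mu nu <= EP)%E.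
Proof. by apply: ereal_inf_lbound; exists P => //; exact: couplings_product. Qed.

(** The competitor is the product coupling itself, with density 1 and hence regularization term
    [eps / 2]. *)
Lemma QOT_le_product (eps : R) : (QOT eps mu nu <= EP + (eps / 2)%:E)%E.
Proof.
apply: ereal_inf_lbound; exists ((P : probability _ R), cst 1) => /=.
  split; first exact: couplings_product.
  by split => // A mA /=; rewrite (integral_cst P mA 1%E) mul1e.
rewrite /QOT_obj /transport_cost/= expr1n (integral_cst P measurableT 1%E) mul1e.
by rewrite [X in (_ * X)%E]probability_setT mule1.
Qed.

(** The product of the unit balls carries the product measure, and the cost is at most 2 there. *)
Lemma cost_product_lty : mu (eball 0 1) = 1%E -> nu (eball 0 1) = 1%E ->
  (EP < +oo)%E.
Proof.
move=> mu1 nu1; pose B := eball (0 : V) 1 `*` eball (0 : V) 1.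
have mB : measurable B by apply: measurableX; exact: measurable_eball.
have PB1 : P B = 1%E.
  rewrite [LHS]product_measure1E//; [|exact: measurable_eball..].
  exact: (etrans (congr2 mule mu1 nu1) (mule1 _)).
have PB : P (~` B) = 0%E.
  by rewrite [LHS]probability_setC// [X in (_ - X)%E]PB1 subee.
apply: (@le_lt_trans _ _ (\int[P]_z 2%:E)%E).
  apply: ae_ge0_le_integral => //.
  - by move=> z _; rewrite lee_fin cost_ge0.
  - by apply/measurable_EFinP; exact: measurable_cost.
  - exists (~` B); split => //; first exact: measurableC.
    move=> [x y] /= h [xB yB]; apply: h => _; rewrite lee_fin /cost/=.
    move: xB yB; rewrite /eball/= !subr0 => x1 y1.
    have := enormD x (- y); rewrite enormN.
    have := enorm_ge0 (x - y); move: (enorm _) (enorm x) (enorm y) x1 y1.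
    by move=> a b c x1 y1 a0 H; nra.
by rewrite integral_cst//= probability_setT mule1 ltry.
Qed.

End values.

(** * The distance bound *)

Section value_gap.
Context {R : realType} {d : nat}.
Local Notation V := 'rV[R]_d.
Variables (mu nu : probability V R).

(** The optimizer is a coupling, so its transport cost is at least [OT]; cancelling the finite [OT]
    leaves the regularization term below the gap. *)
Lemma regularization_le_gap (eps D : R) (p : probability (V * V)%type R)
    (f : V * V -> R) : 0 < eps -> couplings mu nu p ->
  QOT_obj eps mu nu p f = QOT eps mu nu -> OT mu nu \is a fin_num ->
  (QOT eps mu nu - OT mu nu <= D%:E)%E ->
  (\int[(mu \x nu)%E]_z ((f z) ^+ 2)%:E <= (2 * D / eps)%:E)%E.
Proof.
move=> e0 cp <- OTfin; rewrite /QOT_obj leeBlDr// => h.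
have : (OT mu nu + (eps / 2)%:E * \int[(mu \x nu)%E]_z ((f z) ^+ 2)%:E <=
    OT mu nu + D%:E)%E.
  rewrite [leRHS]addeC; apply: le_trans h; apply: leeD => //.
  by apply: ereal_inf_lbound; exists p.
rewrite leeD2lE// => {}h.
rewrite (_ : 2 * D / eps = (eps / 2)^-1 * D); last by rewrite invf_div; ring.
by rewrite EFinM lee_pdivlMl ?divr_gt0.
Qed.

End value_gap.

(* If the whole support lay in the tube of radius [r < c] around the graph of [T], then
   [P] would charge that tube with too little mass for a density of L2-norm [<= M]. *)
Lemma hdist_mspt_ge {R : realType} {d : nat} (mu nu : probability 'rV[R]_d.+1 R)
    (p : probability ('rV[R]_d.+1 * 'rV[R]_d.+1)%type R)
    (f : 'rV[R]_d.+1 * 'rV[R]_d.+1 -> R)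
    (T : 'rV[R]_d.+1 -> 'rV[R]_d.+1) (L lam M c : R) :
  0 <= L -> (forall x y, enorm (T x - T y) <= L * enorm (x - y)) -> 0 < lam ->
  (forall (y : 'rV[R]_d.+1) (t : R), 0 < t ->
    (nu (eball y t) <= (lam * (omega_d R d.+1 * t ^+ d.+1))%:E)%E) ->
  is_density p (mu \x nu)%E f -> 0 < M ->
  (\int[(mu \x nu)%E]_z ((f z) ^+ 2)%:E <= M%:E)%E ->
  M * (lam * (1 + L ^+ 2) `^ (d.+1%:R / 2) * omega_d R d.+1) * c ^+ d.+1 <= 1 ->
  (c%:E <= hdist (mspt p) (graph_of T))%E.
Proof.
move=> L0 Tlip lam0 nule [mf f0 pE] M0 fM Mc; rewrite leNgt; apply/negP => hc.
have S0 : mspt p !=set0.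
  apply/set0P/negP => /eqP m0; have := mspt_rVX_full p.
  by rewrite m0 measure0 => /eqP; rewrite eqe eq_sym oner_eq0.
have [r /andP[r0 rc] rS] := hdist_tube _ _ L0 Tlip _ _ S0 hc.
set t := Num.sqrt (1 + L ^+ 2) * r in rS.
have L1 : 0 < 1 + L ^+ 2 by have := sqr_ge0 L; lra.
have t0 : 0 < t by rewrite mulr_gt0// sqrtr_gt0.
have mt := measurable_tube _ _ L0 Tlip t.
have pt : p (tube T t) = 1%E.
  apply/eqP; rewrite eq_le probability_le1//= -(mspt_rVX_full p).
  apply: le_measure => //; rewrite inE//.
  by apply: closed_rVX_measurable; exact: mspt_closed.
have Pt := product_tube_le _ _ L0 Tlip mu nu t _ (fun x => nule x t t0).
have := density_mass_bound p (mu \x nu)%E f _ _ _ mf f0 pE mt pt Pt M0 fM.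
rewrite leNgt => /negP; apply; apply: lt_le_trans Mc.
move: (omega_d R d.+1) (@omega_d_gt0 R d) => w w0.
rewrite exprMn sqrt_exprn ?ltW// -!mulrA ltr_pM2l// ltr_pM2l//.
rewrite mulrCA ltr_pM2l ?powR_gt0// ltr_pM2l//.
by rewrite ltr_pXn2r// ?nnegrE; lra.
Qed.

Theorem theorem3p6 (R : realType) (d : nat) (d_gt0 : (0 < d)%N)
  (mu nu : probability 'rV[R]_d R)
  (* (i) *)
  (Omega : set 'rV[R]_d) (rho_mu : 'rV[R]_d -> R) (lam_mu Lam_mu : R)
  (hOmega : lipschitz_domain Omega)
  (hOmega_ball : Omega `<=` eball 0 1)
  (hrho_meas : measurable_fun Omega rho_mu)
  (hlam : 0 < lam_mu) (hlamle : lam_mu <= Lam_mu)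
  (hrho_bd : exists N : set 'rV[R]_d, lebesgue_d N = 0%E /\
     forall x, Omega x -> ~ N x -> lam_mu <= rho_mu x <= Lam_mu)
  (hmu : forall A : set 'rV[R]_d, measurable A ->
     mu A = (\int[@lebesgue_d R d]_(x in A `&` Omega) (rho_mu x)%:E)%E)
  (* (ii) *)
  (rho_nu : 'rV[R]_d -> R) (Lam_nu : R)
  (hrho_nu_meas : measurable_fun setT rho_nu)
  (hrho_nu_ge0 : forall y, 0 <= rho_nu y)
  (hnu : forall A : set 'rV[R]_d, measurable A ->
     nu A = (\int[@lebesgue_d R d]_(y in A) (rho_nu y)%:E)%E)
  (hspt_nu : mspt nu `<=` eball 0 1)
  (hLam_nu : forall y, mspt nu y -> rho_nu y <= Lam_nu)
  (* (iii) Brenier map T = grad phi, L-Lipschitz *)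
  (T : 'rV[R]_d -> 'rV[R]_d) (phi : 'rV[R]_d -> R) (L : R)
  (hphi : convex_fun phi)
  (hgrad : exists N : set 'rV[R]_d, measurable N /\ mu N = 0%E /\
     forall x, ~ N x -> has_gradient phi x (T x))
  (hpush : forall B : set 'rV[R]_d, measurable B -> nu B = mu (T @^-1` B))
  (hL : 0 <= L)
  (hTlip : forall x y, enorm (T x - T y) <= L * enorm (x - y))
  (* value gap constant *)
  (C_val : R) (hCval1 : 1 <= C_val)
  (hCval : forall eps : R, 0 < eps -> eps <= 1 ->
     ((C_val^-1 * eps `^ (2 / (2 + d%:R)))%:E <= QOT eps mu nu - OT mu nu
      <= (C_val * eps `^ (2 / (2 + d%:R)))%:E)%E) :
  let C0 := Lam_nu * (1 + L ^+ 2) `^ (d%:R / 2) * omega_d R d in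
  let C_lin := fine (\int[(mu \x nu)%E]_z (cost z)%:E - OT mu nu)%E + 2^-1 in
  let c_sm := (2 * C0 * C_val)^-1 `^ (d%:R^-1) in
  let c_lg := (2 * C0 * C_lin)^-1 `^ (d%:R^-1) in
  0 < c_lg /\
  forall (eps : R) (pi_eps : probability ('rV[R]_d * 'rV[R]_d)%type R),
    0 < eps -> is_QOT_optimizer eps mu nu pi_eps ->
    [/\ eps <= 1 ->
          ((c_sm * eps `^ (1 / (2 + d%:R)))%:E
             <= hdist (mspt pi_eps) (graph_of T))%E,
        1 <= eps -> (c_lg%:E <= hdist (mspt pi_eps) (graph_of T))%E &
        ((Num.min (c_sm * eps `^ (1 / (2 + d%:R))) c_lg)%:E
             <= hdist (mspt pi_eps) (graph_of T))%E].
Proof.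
(* A positive dimension is a successor, the form in which the facts on [lebesgue_d] are stated. *)
case: d d_gt0 mu nu Omega rho_mu hOmega hOmega_ball hrho_meas hrho_bd hmu rho_nu
  hrho_nu_meas hrho_nu_ge0 hnu hspt_nu hLam_nu T phi hphi hgrad hpush hTlip hCval
  => [//|n] _ mu nu Omega rho_mu [oOmega _ _ _] OmegaB _ _ hmu rho mrho rho0 nuE nuB rho_le
  T _ _ _ _ Tlip hCval C0 C_lin c_sm c_lg.
(* Both marginals live in the unit ball, which makes the product cost and [OT] finite, so that the
   [fine] in [C_lin] takes the true value. *)
have mu1 : mu (eball 0 1) = 1%E.
  apply/eqP; rewrite eq_le probability_le1/=; last exact: measurable_eball.
  have mO : measurable Omega by exact: open_rV_measurable.
  have O0 : mu (~` Omega) = 0%E.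
    by rewrite hmu ?setICl ?integral_set0//; exact: measurableC.
  have <- : mu Omega = 1%E.
    have := probability_setC mu mO; rewrite O0 => /esym/eqP.
    by rewrite sube_eq// ?fin_num_measure// add0e => /eqP.
  by apply: le_measure => //; rewrite inE//; exact: measurable_eball.
have nu1 : nu (eball 0 1) = 1%E.
  apply/eqP; rewrite eq_le probability_le1/=; last exact: measurable_eball.
  rewrite -[leLHS](mspt_rV_full nu); apply: le_measure => //; rewrite inE.
    by apply: closed_rV_measurable; exact: mspt_closed.
  exact: measurable_eball.
have lam0 := density_bound_gt0 nu rho Lam_nu mrho rho0 nuE rho_le nuB.
have nule := measure_eball_le nu rho Lam_nu mrho rho0 nuE rho_le.
have L1 : 0 < 1 + L ^+ 2 by have := sqr_ge0 L; lra.
have C00 : 0 < C0.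
  apply: mulr_gt0; last exact: omega_d_gt0.
  by apply: mulr_gt0 => //; exact: powR_gt0.
have clty := cost_product_lty mu nu mu1 nu1.
have [ot otE] : exists ot, OT mu nu = ot%:E.
  exists (fine (OT mu nu)); rewrite fineK// ge0_fin_numE ?OT_ge0//.
  exact: le_lt_trans (OT_le_product mu nu) clty.
have [c cE] : exists c, (\int[(mu \x nu)%E]_z (cost z)%:E = c%:E)%E.
  exists (fine (\int[(mu \x nu)%E]_z (cost z)%:E)); rewrite fineK// ge0_fin_numE//.
  by apply: integral_ge0 => z _; rewrite lee_fin cost_ge0.
(* This gives [C_lin] the lower bound 1/2. *)
have otc : ot <= c by rewrite -lee_fin -otE -cE OT_le_product.
have C_linE : C_lin = c - ot + 2^-1 by rewrite /C_lin cE otE.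
have C_lin0 : 0 < C_lin by rewrite C_linE; lra.
have C_val0 : 0 < C_val by lra.
have N0 : n.+1%:R != 0 :> R by rewrite pnatr_eq0.
have rootK (x : R) : 0 <= x -> (x `^ n.+1%:R^-1) ^+ n.+1 = x.
  by move=> x0; rewrite -powR_mulrn ?powR_ge0// -powRrM mulVf// powRr1.
have OTfin : OT mu nu \is a fin_num by rewrite otE.
have iC0 k : 0 < k -> 0 < (2 * C0 * k)^-1.
  by move=> k0; rewrite invr_gt0; apply: mulr_gt0 => //; exact: mulr_gt0.
have clg0 : 0 < c_lg by apply: powR_gt0; exact: iC0.
split=> // eps p e0 [cp [f [fp fE]]].
have small : eps <= 1 -> ((c_sm * eps `^ (1 / (2 + n.+1%:R)))%:E <=
    hdist (mspt p) (graph_of T))%E.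
  move=> e1; have /andP[_ gap] := hCval _ e0 e1.
  have fM := regularization_le_gap mu nu _ _ p f e0 cp fE OTfin gap.
  (* Here $M = 2 C_{val} \varepsilon^{2/(2+d)} / \varepsilon$, and [c_sm] is chosen to make $M C_0
     c^d$ equal to 1. *)
  apply: (hdist_mspt_ge mu nu p f T L Lam_nu _ _ hL Tlip lam0 nule fp _ fM).
    by rewrite divr_gt0// !mulr_gt0// powR_gt0.
  rewrite exprMn rootK; last exact/ltW/iC0.
  rewrite -/C0.
  set s := 2 + n.+1%:R : R; have s0 : s != 0 by rewrite gt_eqF// ltr_wpDr.
  (* The exponents $2/(2+d)$ and $d/(2+d)$ add up to 1. *)
  have es : eps `^ (2 / s) * (eps `^ (1 / s)) ^+ n.+1 = eps.
    rewrite -powR_mulrn ?powR_ge0// -powRrM -powRD; last by apply/implyP => _; rewrite gt_eqF.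
    rewrite (_ : 2 / s + 1 / s * n.+1%:R = s / s) ?divff ?powRr1 ?ltW//.
    by rewrite /s; field.
  rewrite (_ : _ * _ = (eps `^ (2 / s) * (eps `^ (1 / s)) ^+ n.+1) / eps).
    by rewrite es divff// gt_eqF.
  move: (eps `^ (2 / s)) (_ ^+ n.+1) => x y.
  by field; rewrite !gt_eqF.
have large : 1 <= eps -> (c_lg%:E <= hdist (mspt p) (graph_of T))%E.
  move=> e1.
  (* Testing with the product bounds the gap by [c - ot + eps / 2]; since [c - ot >= 0] and
     [eps >= 1], this is at most [eps * C_lin]. *)
  have gap : (QOT eps mu nu - OT mu nu <= (eps * C_lin)%:E)%E.
    rewrite leeBlDr// (le_trans (QOT_le_product mu nu eps))// cE otE -!EFinD lee_fin.
    by rewrite C_linE; nra.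
  have fM := regularization_le_gap mu nu _ _ p f e0 cp fE OTfin gap.
  (* The factor [eps] cancels in $M = 2 \varepsilon C_{lin} / \varepsilon$, so the radius does not
     depend on [eps], and again $M C_0 c^d = 1$. *)
  apply: (hdist_mspt_ge mu nu p f T L Lam_nu _ _ hL Tlip lam0 nule fp _ fM).
    by rewrite divr_gt0// !mulr_gt0.
  rewrite rootK; last exact/ltW/iC0.
  rewrite -/C0.
  rewrite (_ : _ * _ = 1)//.
  by field; rewrite !gt_eqF.
split=> //; have [e1|e1] := leP eps 1.
  by apply: le_trans (small e1); rewrite lee_fin ge_min lexx.
by apply: le_trans (large (ltW e1)); rewrite lee_fin ge_min lexx orbT.
Qed.
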